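(* Let $\widehat{A}=A+\varepsilon B$ be an $n\times n$ dual matrix with $A,B\in\mathbb{R}^{n\times n}$. Then the dual core generalized inverse of $\widehat{A}$ exists if and only if the dual index of $\widehat{A}$ is one.
   Context: Dual numbers are $a+\varepsilon a'$ with $a,a'\in\mathbb{R}$ and $\varepsilon\neq 0$, $\varepsilon^2=0$ (i.e. the ring $\mathbb{R}[\varepsilon]/(\varepsilon^2)$). A dual matrix is a matrix over dual numbers, written $\widehat{A}=A+\varepsilon B$ with $A,B$ real; its transpose is $\widehat{A}^{T}=A^{T}+\varepsilon B^{T}$. The range $\mathcal{R}(\widehat{A})$ of an $n\times n$ dual matrix is $\{\widehat{A}\widehat{x}: \widehat{x}$ a dual column vector of length $n\}$. The dual index of $\widehat{A}$ is said to be equal to one if $\mathcal{R}(\widehat{A}^2)=\mathcal{R}(\widehat{A})$. The dual core generalized inverse (DCGI) of $\widehat{A}$ is an $n\times n$ dual matrix $\widehat{G}$ with $\widehat{A}\widehat{G}\widehat{A}=\widehat{A}$, $\widehat{A}\widehat{G}^2=\widehat{G}$, $(\widehat{A}\widehat{G})^{T}=\widehat{A}\widehat{G}$; it may or may not exist. *)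

(* Defs.v *)
From HB Require Import structures.
From mathcomp Require Import all_boot all_order all_algebra.
From mathcomp Require Import classical_sets reals.

Set Implicit Arguments.
Unset Strict Implicit.
Unset Printing Implicit Defensive.

Import GRing.Theory.
Local Open Scope ring_scope.

(* R[eps]/(eps^2): [Dual a a'] is a + eps a' (see [dualE] and [deps_sqr]). *)
Record dualnum (R : Type) := Dual { dual_std : R; dual_inf : R }.

Definition dual_pair (R : Type) (x : dualnum R) : R * R :=
  (dual_std x, dual_inf x).
Definition pair_dual (R : Type) (x : R * R) : dualnum R := Dual x.1 x.2.

Lemma dual_pairK (R : Type) : cancel (@dual_pair R) (@pair_dual R).
Proof. by case. Qed.

HB.instance Definition _ (R : eqType) :=
  Equality.copy (dualnum R) (can_type (@dual_pairK R)).
HB.instance Definition _ (R : choiceType) :=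
  Choice.copy (dualnum R) (can_type (@dual_pairK R)).

Section DualZmodule.
Variable R : zmodType.
Implicit Types x y z : dualnum R.

Definition dual_zero : dualnum R := Dual 0 0.
Definition dual_opp x := Dual (- dual_std x) (- dual_inf x).
Definition dual_add x y :=
  Dual (dual_std x + dual_std y) (dual_inf x + dual_inf y).

Lemma dual_addA : associative dual_add.
Proof. by move=> x y z; rewrite /dual_add /= !addrA. Qed.
Lemma dual_addC : commutative dual_add.
Proof. by move=> x y; congr Dual; rewrite addrC. Qed.
Lemma dual_add0 : left_id dual_zero dual_add.
Proof. by case=> a a'; rewrite /dual_add /= !add0r. Qed.
Lemma dual_addN : left_inverse dual_zero dual_opp dual_add.
Proof. by move=> x; rewrite /dual_add /= !addNr. Qed.

HB.instance Definition _ := GRing.isZmodule.Build (dualnum R)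
  dual_addA dual_addC dual_add0 dual_addN.

End DualZmodule.

Section DualRing.
Variable R : comNzRingType.
Implicit Types x y z : dualnum R.

Definition dual_one : dualnum R := Dual 1 0.
Definition dual_mul x y :=
  Dual (dual_std x * dual_std y)
       (dual_std x * dual_inf y + dual_inf x * dual_std y).

Lemma dual_mulA : associative dual_mul.
Proof.
by move=> x y z; rewrite /dual_mul /= mulrDr mulrDl !mulrA addrA.
Qed.
Lemma dual_mulC : commutative dual_mul.
Proof.
move=> x y; congr Dual; first exact: mulrC.
by rewrite addrC; congr (_ + _); exact: mulrC.
Qed.
Lemma dual_mul1 : left_id dual_one dual_mul.
Proof. by case=> a a'; rewrite /dual_mul /= !mul1r mul0r addr0. Qed.
Lemma dual_mulDl : left_distributive dual_mul +%R.
Proof.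
by move=> x y z; rewrite /dual_mul; congr Dual; rewrite /= !mulrDl // addrACA.
Qed.
Lemma dual_one_neq0 : dual_one != 0.
Proof. by apply/eqP => -[] /eqP; rewrite oner_eq0. Qed.

HB.instance Definition _ := GRing.Zmodule_isComNzRing.Build (dualnum R)
  dual_mulA dual_mulC dual_mul1 dual_mulDl dual_one_neq0.

Definition dual_of (a : R) : dualnum R := Dual a 0.
Definition deps : dualnum R := Dual 0 1.

Lemma deps_neq0 : deps != 0.
Proof. by apply/eqP => -[] /eqP; rewrite oner_eq0. Qed.

Lemma deps_sqr : deps ^+ 2 = 0.
Proof. by congr Dual; rewrite /= !(mul0r, mulr0) ?addr0. Qed.

Lemma dualE (a a' : R) : Dual a a' = dual_of a + deps * dual_of a'.
Proof. by congr Dual; rewrite /= !(mul0r, mul1r, add0r, addr0). Qed.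

Lemma dual_of_is_zmod_morphism : zmod_morphism dual_of.
Proof. by move=> a b; congr Dual; rewrite /= subrr. Qed.
Lemma dual_of_is_monoid_morphism : monoid_morphism dual_of.
Proof.
by split=> // a b; congr Dual; rewrite /= mulr0 mul0r addr0.
Qed.
HB.instance Definition _ := GRing.isZmodMorphism.Build R (dualnum R) dual_of
  dual_of_is_zmod_morphism.
HB.instance Definition _ := GRing.isMonoidMorphism.Build R (dualnum R) dual_of
  dual_of_is_monoid_morphism.

Definition dual_mx (m n : nat) (A B : 'M[R]_(m, n)) : 'M[dualnum R]_(m, n) :=
  map_mx dual_of A + deps *: map_mx dual_of B.

Lemma dual_mxE (m n : nat) (A B : 'M[R]_(m, n)) i j :
  dual_mx A B i j = Dual (A i j) (B i j).
Proof. by rewrite !mxE -dualE. Qed.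

Lemma trmx_dual_mx (m n : nat) (A B : 'M[R]_(m, n)) :
  (dual_mx A B)^T = dual_mx A^T B^T.
Proof. by apply/matrixP=> i j; rewrite mxE !dual_mxE !mxE. Qed.

Definition dual_range (n : nat) (A : 'M[dualnum R]_n) : set 'cV[dualnum R]_n :=
  range (fun x : 'cV[dualnum R]_n => A *m x).

Definition dual_index_one (n : nat) (A : 'M[dualnum R]_n) : Prop :=
  dual_range (A *m A) = dual_range A.

Definition is_dcgi (n : nat) (A G : 'M[dualnum R]_n) : Prop :=
  [/\ A *m G *m A = A, A *m (G *m G) = G & (A *m G)^T = A *m G].

End DualRing.

Arguments deps {R}.

(* Main.v *)
(** If A = A^2 X, the real part of A has index one, so that A = Z A^2 for some
    dual Z as well; then A X A = A, and P = A X is an idempotent with range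
    R(A).  Symmetrising P into the orthogonal projector Q onto R(A) turns the
    generalized inverse A X^2 into the core inverse A X^2 Q.  Conversely a DCGI
    G gives A = A G A = A^2 (G^2 A). *)

Require Import Defs.
From mathcomp Require Import all_boot all_order all_algebra.
From mathcomp Require Import classical_sets reals.
From mathcomp Require Import boolp.

Set Implicit Arguments.
Unset Strict Implicit.
Unset Printing Implicit Defensive.

Import Order.TTheory GRing.Theory Num.Theory.
Local Open Scope ring_scope.

Section IndexOneMatrix.
Variables (S : comNzRingType) (n : nat).
Implicit Types A C P Q W X Y Z : 'M[S]_n.

(** Right multiplication by [A *m X] fixes [A], hence every left multiple of [A]. For an approximate
    left factor [Y], the error is thus unchanged by this product. *)
Lemma sub_sqr_mx_fixed A X Y : A = A *m A *m X ->
  (A - Y *m (A *m A)) *m (A *m X) = A - Y *m (A *m A).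
Proof. by move=> AAX; rewrite mulmxBl -!mulmxA !(mulmxA A A X) -AAX. Qed.

Lemma sqr_mx_factor_add A C Y : C *m (A *m A) = A - Y *m (A *m A) ->
  A = (Y + C) *m (A *m A).
Proof. by move=> CAA; rewrite mulmxDl CAA addrC subrK. Qed.

(* Z commutes with P and P^T, and Z P = P P^T P; take Q = P P^T Z^-1. *)
Lemma orthogonal_projector_of_inverse P W (D := P - P^T)
    (Z := 1%:M + D *m D^T) :
    P *m P = P -> Z *m W = 1%:M -> W *m Z = 1%:M ->
  exists Q, [/\ Q *m P = P, P *m Q = Q & Q^T = Q].
Proof.
move=> PP ZW WZ.
have PtPt : P^T *m P^T = P^T by rewrite -trmx_mul PP.
have trZ : Z^T = Z by rewrite /Z raddfD /= trmx1 trmx_mul trmxK.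
have trD : D^T = P^T - P by rewrite /D raddfB /= trmxK.
have ZP : Z *m P = P *m P^T *m P.
  rewrite /Z trD mulmxDl mul1mx -mulmxA (mulmxBl P^T P) PP /D mulmxBr.
  by rewrite !mulmxBl PP !mulmxA PtPt opprB subrKA subrKC.
have PZ : P *m Z = P *m P^T *m P.
  rewrite /Z trD mulmxDr mulmx1 mulmxA /D (mulmxBr P P) PP mulmxBr !mulmxBl PP.
  by rewrite -(mulmxA P P^T P^T) PtPt subrr sub0r opprB subrKC.
(* Transposing the commutation of the symmetric [Z] with [P]. *)
have PtZ : P^T *m Z = Z *m P^T by rewrite -{1}trZ -trmx_mul ZP -PZ trmx_mul trZ.
have comm_W : P *m P^T *m W = W *m (P *m P^T).
  rewrite -[LHS]mul1mx -WZ -[in LHS]mulmxA; congr (_ *m _).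
  by rewrite !mulmxA ZP -PZ -(mulmxA P) -PtZ -!mulmxA ZW mulmx1.
exists (P *m P^T *m W); split.
(* [Q P = W (P P^T P) = W Z P = P]. *)
- by rewrite comm_W -!mulmxA (mulmxA P) -ZP mulmxA WZ mul1mx.
- by rewrite !mulmxA PP.
have trW : W^T = W.
  by rewrite -[LHS]mulmx1 -ZW mulmxA -{1}trZ -trmx_mul ZW trmx1 mul1mx.
by rewrite trmx_mul trmx_mul trmxK trW comm_W.
Qed.

(** The product [A *m G] collapses to [Q], and [Q] fixes [A = A *m X *m A] because it fixes
    [A *m X]. *)
Lemma core_inverse_of_projector A X Q (G := A *m X *m X *m Q) :
    A = A *m A *m X -> A *m X *m A = A ->
    Q *m (A *m X) = A *m X -> A *m X *m Q = Q -> Q^T = Q ->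
  [/\ A *m G *m A = A, A *m (G *m G) = G & (A *m G)^T = A *m G].
Proof.
move=> AAX AXA QP PQ trQ.
have AG : A *m G = Q by rewrite /G !mulmxA -AAX.
have QA : Q *m A = A by rewrite -{1}AXA mulmxA QP AXA.
split; rewrite ?(mulmxA A G G) AG //.
by rewrite /G !mulmxA QA.
Qed.

End IndexOneMatrix.

Section DualMatrix.
Variable R : comNzRingType.

Lemma dual_mx_split m n (M : 'M[dualnum R]_(m, n)) :
  M = dual_mx (map_mx (@dual_std R) M) (map_mx (@dual_inf R) M).
Proof. by apply/matrixP=> i j; rewrite dual_mxE !mxE; case: (M i j). Qed.

Lemma dual_stdK m n (A B : 'M[R]_(m, n)) :
  map_mx (@dual_std R) (dual_mx A B) = A.
Proof. by apply/matrixP=> i j; rewrite mxE dual_mxE. Qed.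

Lemma dual_mxD m n (A B C D : 'M[R]_(m, n)) :
  dual_mx A B + dual_mx C D = dual_mx (A + C) (B + D).
Proof. by apply/matrixP=> i j; rewrite mxE !dual_mxE !mxE. Qed.

Lemma dual_mx1 n : dual_mx 1%:M 0 = 1%:M :> 'M[dualnum R]_n.
Proof. by apply/matrixP=> i j; rewrite dual_mxE !mxE; case: eqP. Qed.

Lemma dual_mxM m n p (A B : 'M[R]_(m, n)) (C D : 'M[R]_(n, p)) :
  dual_mx A B *m dual_mx C D = dual_mx (A *m C) (A *m D + B *m C).
Proof.
rewrite /dual_mx mulmxDl !mulmxDr -!scalemxAl -!scalemxAr scalerA -expr2.
by rewrite deps_sqr scale0r addr0 map_mxD !map_mxM scalerDr addrA.
Qed.

Lemma map_dual_stdM m n p (M : 'M[dualnum R]_(m, n))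
    (N : 'M[dualnum R]_(n, p)) :
  map_mx (@dual_std R) (M *m N) =
  map_mx (@dual_std R) M *m map_mx (@dual_std R) N.
Proof.
by rewrite {1}(dual_mx_split M) {1}(dual_mx_split N) dual_mxM dual_stdK.
Qed.

Lemma dual_eps_mxM m n p (C : 'M[R]_(m, n)) (N : 'M[dualnum R]_(n, p)) :
  dual_mx 0 C *m N = dual_mx 0 (C *m map_mx (@dual_std R) N).
Proof. by rewrite {1}(dual_mx_split N) dual_mxM !mul0mx add0r. Qed.

(** The columns of [A] lie in its range; preimages of them under [C], picked by choice, are the
    columns of [X]. *)
Lemma dual_range_subP n (A C : 'M[dualnum R]_n) :
  (dual_range A `<=` dual_range C)%classic <-> exists X, A = C *m X.
Proof.
split=> [sAC | [X ->] _ [x _ <-]]; last by exists (X *m x); rewrite ?mulmxA.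
have /all_sig2 [x _ xP] j : {x : 'cV_n | true & C *m x = col j A}.
  apply/cid2; have [|x _ xj] := sAC (col j A); last by exists x.
  by exists (delta_mx j 0) => //; rewrite colE.
exists (\matrix_(i, j) x j i 0); apply/matrixP=> i j.
have /matrixP/(_ i 0) := xP j; rewrite !mxE => <-.
by apply: eq_bigr => k _; rewrite mxE.
Qed.

(** Only one inclusion has content: the range of [A *m A] always lies in that of [A]. *)
Lemma dual_index_oneP n (A : 'M[dualnum R]_n) :
  dual_index_one A <-> exists X, A = A *m A *m X.
Proof.
rewrite -dual_range_subP; split=> [-> //|sA].
by apply/seteqP; split=> //; apply/dual_range_subP; exists A.
Qed.

Lemma std_1_add_mul_tr n (D : 'M[dualnum R]_n) (d := map_mx (@dual_std R) D) :
  map_mx (@dual_std R) (1%:M + D *m D^T) = 1%:M + d *m d^T.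
Proof.
rewrite /d (dual_mx_split D) trmx_dual_mx dual_mxM -dual_mx1 dual_mxD.
by rewrite !dual_stdK.
Qed.

(** The Neumann series of the inverse of [a + eps b] stops after its first-order term, since [eps]
    squares to zero. *)
Lemma dual_mx_right_inverse n (a b : 'M[R]_n) w :
  a *m w = 1%:M -> dual_mx a b *m dual_mx w (- (w *m b *m w)) = 1%:M.
Proof.
by move=> aw; rewrite dual_mxM aw mulmxN !mulmxA aw mul1mx addNr dual_mx1.
Qed.

Lemma dual_mx_left_inverse n (a b : 'M[R]_n) w :
  w *m a = 1%:M -> dual_mx w (- (w *m b *m w)) *m dual_mx a b = 1%:M.
Proof.
by move=> wa; rewrite dual_mxM mulNmx -(mulmxA (w *m b)) wa mulmx1 subrr dual_mx1.
Qed.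

Lemma dual_sub_std0 n (A Y : 'M[dualnum R]_n)
    (a := map_mx (@dual_std R) A) (y := map_mx (@dual_std R) Y) :
  a = y *m (a *m a) ->
  exists c, A - Y *m (A *m A) = dual_mx 0 c.
Proof.
move=> aa; set E := A - _; exists (map_mx (@dual_inf R) E).
rewrite {1}(dual_mx_split E); congr dual_mx.
have -> : map_mx (@dual_std R) E =
          a - map_mx (@dual_std R) (Y *m (A *m A)).
  by apply/matrixP=> i j; rewrite !mxE.
by rewrite !map_dual_stdM -/a -/y -aa subrr.
Qed.

(* A - z A^2 = eps c is fixed by right multiplication by A X, and
   c a x = c z a = (c z^2) a^2. *)
Lemma dual_sqr_mx_left_factor n (A X : 'M[dualnum R]_n) z
    (a := map_mx (@dual_std R) A) :
  A = A *m A *m X -> a = z *m (a *m a) -> exists Z, A = Z *m (A *m A).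
Proof.
move=> AAX az; pose x := map_mx (@dual_std R) X.
have aax : a = a *m a *m x by rewrite /a {1}AAX !map_dual_stdM.
(* Both sides equal [z a^2 x]. *)
have ax : a *m x = z *m a by rewrite {1}az -!mulmxA (mulmxA a) -aax.
have [|c Ec] := @dual_sub_std0 n A (dual_mx z 0); first by rewrite dual_stdK.
exists (dual_mx z 0 + dual_mx 0 (c *m z *m z)); apply: sqr_mx_factor_add.
rewrite -(sub_sqr_mx_fixed _ AAX) Ec !dual_eps_mxM !map_dual_stdM -/a -/x ax.
by rewrite -(mulmxA (c *m z)) -az mulmxA.
Qed.

End DualMatrix.

(** The hypothesis forces [a] and [a *m a] to have equal rank, so the row space of [a *m a],
    contained in that of [a], is all of it. This dimension count is made over a field, on real
    parts, and then lifted to dual matrices. *)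
Lemma sqr_mx_inv_sides (F : fieldType) n (a x : 'M[F]_n) :
  a = a *m a *m x -> exists z, a = z *m (a *m a).
Proof.
move=> aax; apply/submxP.
have [_ <-] := mxrank_leqif_sup (submxMl a a).
by rewrite eqn_leq mxrankM_maxr {1}aax mxrankM_maxl.
Qed.

Lemma dual_sqr_mx_inv_sides (F : fieldType) n (A X : 'M[dualnum F]_n) :
  A = A *m A *m X -> exists Z, A = Z *m (A *m A).
Proof.
move=> AAX; have [|z] := @sqr_mx_inv_sides F n (map_mx (@dual_std F) A)
  (map_mx (@dual_std F) X); first by rewrite {1}AAX !map_dual_stdM.
exact: dual_sqr_mx_left_factor AAX.
Qed.

Lemma row_dot_ge0 (F : realDomainType) n (v : 'rV[F]_n) :
  0 <= (v *m v^T) 0 0.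
Proof. by rewrite mxE sumr_ge0 // => i _; rewrite mxE -expr2 sqr_ge0. Qed.

Lemma row_dot_eq0 (F : realDomainType) n (v : 'rV[F]_n) :
  (v *m v^T) 0 0 = 0 -> v = 0.
Proof.
rewrite mxE => v0; apply/rowP=> j; apply/eqP; rewrite mxE -sqrf_eq0 expr2.
have := psumr_eq0P (fun i _ => _) v0 => /(_ _ j isT); rewrite mxE => -> // i.
by rewrite mxE -expr2 sqr_ge0.
Qed.

(** Pairing a left kernel vector [v] with itself gives [|v|^2 + |v M|^2 = 0], hence [v = 0]. *)
Lemma unitmx_1_add_mul_tr (F : realFieldType) n (M : 'M[F]_n) :
  1%:M + M *m M^T \in unitmx.
Proof.
rewrite -row_free_unit; apply: inj_row_free => v v0; apply: row_dot_eq0.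
have : (v *m v^T) 0 0 + (v *m M *m (v *m M)^T) 0 0 = 0.
  have := congr1 (fun w => (w *m v^T) 0 0) v0.
  by rewrite mul0mx mulmxDr mulmx1 mulmxDl trmx_mul !mulmxA mxE [RHS]mxE.
by move/eqP; rewrite paddr_eq0 ?row_dot_ge0 // => /andP[/eqP].
Qed.

Lemma dual_mx_invertible (F : fieldType) n (M : 'M[dualnum F]_n) :
  map_mx (@dual_std F) M \in unitmx ->
  exists W, M *m W = 1%:M /\ W *m M = 1%:M.
Proof.
move=> uM; rewrite (dual_mx_split M); eexists; split.
  exact/dual_mx_right_inverse/mulmxV.
exact/dual_mx_left_inverse/mulVmx.
Qed.

Lemma idempotent_orthogonal_projector (F : realFieldType) n
    (P : 'M[dualnum F]_n) : P *m P = P ->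
  exists Q, [/\ Q *m P = P, P *m Q = Q & Q^T = Q].
Proof.
move=> PP; pose D := P - P^T.
have [|W [ZW WZ]] := @dual_mx_invertible F n (1%:M + D *m D^T).
  (* Invertibility is decided on the real part, which again has the form [1 + d d^T]. *)
  by rewrite std_1_add_mul_tr; apply: unitmx_1_add_mul_tr.
exact: orthogonal_projector_of_inverse PP ZW WZ.
Qed.

Theorem theorem3p3 (R : realType) (n : nat) (A B : 'M[R]_n) :
  (exists G : 'M[dualnum R]_n, is_dcgi (dual_mx A B) G) <->
  dual_index_one (dual_mx A B).
Proof.
rewrite dual_index_oneP; move: (dual_mx A B) => {B}A.
split=> [[G [AGA AGG _]] | [X AAX]].
  exists (G *m G *m A).
  by rewrite -(mulmxA A A) (mulmxA A (G *m G)) AGG mulmxA AGA.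
have [Z ZAA] := dual_sqr_mx_inv_sides AAX.
(* [A X A = Z (A^2 X) A = Z A^2 = A]: the left factor [Z] makes [X] an inner inverse. *)
have AXA : A *m X *m A = A.
  by rewrite {1}ZAA -(mulmxA Z) -AAX -mulmxA -ZAA.
have PP : A *m X *m (A *m X) = A *m X by rewrite mulmxA AXA.
have [Q [QP PQ trQ]] := idempotent_orthogonal_projector PP.
by exists (A *m X *m X *m Q); apply: core_inverse_of_projector.
Qed.
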